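(* Let $G$ be a connected graph and $e\in E(G)$. Then $$\chi_d^t(G)-2\leq \chi_d^t(G/e)\leq \chi_d^t(G)+1.$$
   Context: All graphs are simple and finite. For a graph with no isolated vertex, a total dominator coloring (TD-coloring) is a proper vertex coloring in which every vertex is adjacent to every vertex of some color class (a class other than its own); $\chi_d^t$ denotes the minimum number of colors in such a coloring. For an edge $e=uv$, the contraction $G/e$ is obtained by replacing $u$ and $v$ by a single new vertex adjacent to every vertex (other than $u,v$) that was adjacent to $u$ or $v$ (no parallel edges or loops). Implicitly, every graph whose $\chi_d^t$ appears has no isolated vertex. *)

(* Defs.v *)
From mathcomp Require Import all_boot.

Set Implicit Arguments.
Unset Strict Implicit.
Unset Printing Implicit Defensive.

Record sgraph := SGraph {
  vertex :> finType;
  adj : rel vertex;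
  adj_sym : symmetric adj;
  adj_irr : irreflexive adj
}.

Definition connected (G : sgraph) : Prop := forall x y : G, connect (@adj G) x y.

Definition no_isolated (G : sgraph) : Prop := forall x : G, exists y : G, adj x y.

Section Coloring.
Variables (G : sgraph) (C : finType).

Definition colors_used (c : {ffun G -> C}) : {set C} := [set c x | x : G].

Definition proper_coloring (c : {ffun G -> C}) : bool :=
  [forall x : G, forall y : G, adj x y ==> (c x != c y)].

(* Classes range over the colors actually used: adjacency to every vertex of *)
(* an empty class would hold vacuously.                                      *)
Definition td_coloring (c : {ffun G -> C}) : bool :=
  proper_coloring c &&
  [forall x : G, exists i : C,
     [&& i \in colors_used c, i != c x & [forall y : G, (c y == i) ==> adj x y]]].

End Coloring.

(* Without isolated vertices the coloring giving each vertex its own color   *)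
(* is a TD-coloring, so the default value #|G| of the minimum is harmless    *)
(* (see chi_td_attained); #|G| colors suffice for every coloring.            *)
Definition chi_td (G : sgraph) : nat :=
  \big[minn/#|G|]_(c : {ffun G -> 'I_#|G|} | td_coloring c) #|colors_used c|.

Lemma chi_td_attained (G : sgraph) : no_isolated G ->
  exists2 c : {ffun G -> 'I_#|G|}, td_coloring c & #|colors_used c| = chi_td G.
Proof.
move=> niso; rewrite /chi_td; elim/big_ind: _ => [|m n|c tc]; last by exists c.
  have inj := @enum_rank_inj G.
  exists [ffun x => enum_rank x]; last first.
    rewrite /colors_used -[RHS](card_imset _ inj).
    by apply: eq_card; apply/setP; apply: eq_imset => x; rewrite ffunE.
  apply/andP; split.
    apply/forallP => x; apply/forallP => y; apply/implyP => xy.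
    rewrite !ffunE (inj_eq inj); apply: contraTneq xy => ->.
    by rewrite adj_irr.
  apply/forallP => x; have [y xy] := niso x; apply/existsP.
  exists (enum_rank y); apply/and3P; split.
  - by apply/imsetP; exists y; rewrite ?ffunE.
  - by rewrite ffunE (inj_eq inj); apply: contraTneq xy => ->; rewrite adj_irr.
  - by apply/forallP => z; apply/implyP; rewrite ffunE (inj_eq inj) => /eqP->.
by move=> [c tc <-] [d td <-]; rewrite /minn; case: ifP; [exists c | exists d].
Qed.

Section Contraction.
Variables (G : sgraph) (u v : G).

(* None is the new vertex replacing u and v. *)
Definition contract_vertex : finType := option {x : G | x \notin [set u; v]}.

Definition contract_adj : rel contract_vertex := fun a b =>
  match a, b with
  | Some x, Some y => adj (val x) (val y)
  | None, Some y => adj u (val y) || adj v (val y)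
  | Some x, None => adj u (val x) || adj v (val x)
  | None, None => false
  end.

Lemma contract_adj_sym : symmetric contract_adj.
Proof. by move=> [x|] [y|] //=; rewrite adj_sym. Qed.

Lemma contract_adj_irr : irreflexive contract_adj.
Proof. by move=> [x|] //=; rewrite adj_irr. Qed.

Definition contract : sgraph := SGraph contract_adj_sym contract_adj_irr.

End Contraction.

(* Main.v *)
Require Import Defs.
From mathcomp Require Import all_boot.

(** Lower bound: from a TD-coloring of [G/e], give [u] and [v] two fresh colors.
    Upper bound: from a TD-coloring of [G], give the contracted vertex a fresh
    color.  This fails to dominate a class from the contracted vertex only if
    [{u}] and [{v}] are both color classes; then two colors have disappeared,
    so one neighbor of the contracted vertex can get a second fresh color. *)

Lemma bigminn_le (I : eqType) (m : nat) (s : seq I) (P : pred I) (F : I -> nat)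
    (i : I) :
  i \in s -> P i -> \big[minn/m]_(j <- s | P j) F j <= F i.
Proof.
elim: s => //= j s IHs; rewrite inE big_cons => /predU1P[<- ->|si Pi].
  exact: geq_minl.
by case: ifP => _; [apply: leq_trans (geq_minr _ _) _|]; apply: IHs.
Qed.

(* A class is named by one of its vertices [z], so it is automatically
   nonempty; it differs from the class of [x] because [adj] is irreflexive. *)
Definition td_map (G : sgraph) (C : Type) (c : G -> C) : Prop :=
  (forall x y : G, adj x y -> c x <> c y) /\
  (forall x : G, exists z : G, forall y : G, c y = c z -> adj x y).

Lemma td_coloringP (G : sgraph) (C : finType) (c : {ffun G -> C}) :
  reflect (td_map G C c) (td_coloring c).
Proof.
apply: (iffP andP) => -[pc tc]; split.
- by move=> x y xy; move/forallP/(_ x)/forallP/(_ y)/implyP/(_ xy)/eqP: pc.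
- move=> x; have /existsP[_ /and3P[/imsetP[z _ ->] _ /forallP cz]] := forallP tc x.
  by exists z => y cyz; apply: (implyP (cz y)); apply/eqP.
- apply/forallP => x; apply/forallP => y; apply/implyP => xy; apply/eqP.
  exact: pc.
apply/forallP => x; have [z cz] := tc x; apply/existsP; exists (c z).
apply/and3P; split; first exact: imset_f.
  by apply/eqP => czx; have := cz x (esym czx); rewrite adj_irr.
by apply/forallP => y; apply/implyP => /eqP; apply: cz.
Qed.

(** Only the partition into classes matters: naming each class by the rank of a chosen member turns
    [c] into a coloring by ['I_#|G|] with the same classes. Upper bounds may thus use any color
    type, such as [option] or a sum, where fresh colors are at hand. *)
Lemma chi_td_le (G : sgraph) (C : finType) (c : G -> C) :
  td_map G C c -> chi_td G <= #|[set c x | x : G]|.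
Proof.
move=> [pc tc].
pose rep (i : C) : option G := [pick y | c y == i].
(* The default [x] is never reached, since [x] itself has color [c x]. *)
pose d := [ffun x : G => enum_rank (odflt x (rep (c x)))].
have cK x : c (odflt x (rep (c x))) = c x.
  by rewrite /rep; case: pickP => [y /eqP|].
have cd x y : c x = c y -> d x = d y.
  rewrite !ffunE => <-; rewrite /rep; case: pickP => // /(_ x).
  by rewrite eqxx.
have dc x y : d x = d y -> c x = c y.
  by rewrite !ffunE => /enum_rank_inj rxy; rewrite -(cK x) rxy cK.
have td : td_coloring d.
  apply/td_coloringP; split=> [x y xy /dc|x]; first exact: pc.
  by have [z cz] := tc x; exists z => y /dc; apply: cz.
apply: leq_trans (bigminn_le _ _ _ _ _ _ (mem_index_enum d) td) _.
have -> : colors_used d = (fun x => d x) @: [set odflt x (rep (c x)) | x : G].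
  apply/setP => i; apply/imsetP/imsetP => [[x _ ->]|[x _ ->]]; last by exists x.
  exists (odflt x (rep (c x))); first exact: imset_f.
  by apply: cd; rewrite cK.
apply: leq_trans (leq_imset_card _ _) _.
(* Distinct representatives have distinct colors under [c], so there are at most as many as
   colors. *)
rewrite -(@card_in_imset _ _ c) => [|_ _ /imsetP[x _ ->] /imsetP[y _ ->]].
  by apply/subset_leq_card/subsetP => _ /imsetP[_ /imsetP[x _ ->] ->];
    rewrite cK imset_f.
by rewrite !cK => /cd; rewrite !ffunE => /enum_rank_inj.
Qed.

Lemma chi_td_map (G : sgraph) : no_isolated G ->
  exists2 c : G -> 'I_#|G|, td_map G 'I_#|G| c & #|[set c x | x : G]| = chi_td G.
Proof.
by move=> /chi_td_attained[c /td_coloringP tc <-]; exists c.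
Qed.

Lemma chi_td_le_contract (G : sgraph) (u v : G) :
  adj u v -> no_isolated (contract u v) ->
  chi_td G <= chi_td (contract u v) + 2.
Proof.
move=> uv /chi_td_map[c [pc tc] <-].
(* The two values in [inl] are the fresh colors; [inr] carries the old ones. *)
pose d (x : G) : bool + 'I_#|contract u v| :=
  if insub x is Some y then inr (c (Some y)) else inl (x == u).
have dS (y : {x | x \notin [set u; v]}) : d (val y) = inr (c (Some y)).
  by rewrite /d valK.
have du : d u = inl true by rewrite /d insubF ?eqxx // !inE eqxx.
have dv : d v = inl false.
  rewrite /d insubF ?inE ?eqxx ?orbT //; congr inl.
  by apply: contraTF uv => /eqP ->; rewrite adj_irr.
have VP x : [\/ x = u, x = v | exists y : {x | x \notin [set u; v]}, x = val y].
  have [] := boolP (x \in [set u; v]) => [/set2P[]|nx].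
  - by constructor 1.
  - by constructor 2.
  - by constructor 3; exists (Sub x nx).
have dtrue x : d x = inl true -> x = u.
  by case: (VP x) => [->|->|[y ->]] //; rewrite ?dv ?dS.
have dfalse x : d x = inl false -> x = v.
  by case: (VP x) => [->|->|[y ->]] //; rewrite ?du ?dS.
have td : td_map G _ d.
  split=> [x y|x].
    case: (VP x) => [->|->|[{}x ->]]; case: (VP y) => [->|->|[{}y ->]];
      rewrite ?adj_irr ?du ?dv ?dS // => xy [] /pc; exact.
  case: (VP x) => [->|->|[{}x ->]].
  (* The ends of the edge dominate each other's singleton class. *)
  - by exists v => y; rewrite dv => /dfalse ->.
  - by exists u => y; rewrite du => /dtrue ->; rewrite adj_sym.
  (* A class represented by an old vertex can at most lose [None], so [x] still dominates it. If it
     is represented by [None], then [x] is adjacent to [u] or [v], now singleton classes. *)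
  have [[z|] cz] := tc (Some x).
    exists (val z) => y; rewrite dS.
    by case: (VP y) => [->|->|[{}y ->]]; rewrite ?du ?dv ?dS // => -[/cz].
  have /orP[ux|vx] := cz None erefl.
    by exists u => y; rewrite du => /dtrue ->; rewrite adj_sym.
  by exists v => y; rewrite dv => /dfalse ->; rewrite adj_sym.
apply: leq_trans (chi_td_le _ _ _ td) _.
set K := [set c x | x : _].
apply: (@leq_trans #|[set inl true; inl false] :|: inr @: K|).
  apply/subset_leq_card/subsetP => _ /imsetP[x _ ->].
  case: (VP x) => [->|->|[y ->]]; rewrite ?du ?dv ?dS !inE ?eqxx //.
  by rewrite !imset_f.
rewrite addnC; apply: leq_trans (leq_card_setU _ _) _.
by apply: leq_add; rewrite ?cards2 ?leq_imset_card.
Qed.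

Lemma chi_td_contract_le (G : sgraph) (u v : G) :
  adj u v -> no_isolated G -> no_isolated (contract u v) ->
  chi_td (contract u v) <= chi_td G + 1.
Proof.
move=> uv /chi_td_map[c [pc tc] <-] niso.
set K := [set c x | x : G].
(* First case: some class that survives outside [u] and [v] is covered by their joint neighborhood,
   so the new vertex dominates it and one fresh color suffices. *)
have [/existsP[z /andP[nz wz]]|noz] := boolP [exists z : G, (z \notin [set u; v])
  && [forall y : G, (c y == c z) ==> adj u y || adj v y]].
  pose d (a : contract u v) := if a is Some x then Some (c (val x)) else None.
  have td : td_map (contract u v) _ d.
    split=> [[x|] [y|] //= xy []|[x|]]; first exact: pc.
      have [t ct] := tc (val x).
      (* If [t] is an end of the edge, then [x] is adjacent to the new vertex, whose class is a
         singleton. *)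
      have [tuv|nt] := boolP (t \in [set u; v]).
        exists None => -[y|] //= _; rewrite ![adj _ (val x)]adj_sym.
        by case/set2P: tuv ct => -> /(_ _ erefl) -> //; rewrite orbT.
      exists (Some (Sub t nt)) => -[y|] //= [] /ct; exact.
    exists (Some (Sub z nz)) => -[y|] //= [] /eqP cyz.
    exact: (implyP (forallP wz (val y)) cyz).
  apply: leq_trans (chi_td_le _ _ _ td) _.
  apply: (@leq_trans #|None |: Some @: K|).
    apply/subset_leq_card/subsetP => _ /imsetP[[x|] _ ->]; rewrite !inE //=.
    by rewrite !imset_f.
  rewrite addnC; apply: leq_trans (leq_card_setU _ _) _.
  by apply: leq_add; rewrite ?cards1 ?leq_imset_card.
have nodom z : (forall y, c y = c z -> adj u y || adj v y) -> z \in [set u; v].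
  move=> cz; apply: contraR noz => nz; apply/existsP; exists z; rewrite nz.
  by apply/forallP => y; apply/implyP => /eqP; apply: cz.
(* The class that [u] dominates is covered, so [t] is [u] or [v]; irreflexivity excludes [u]. *)
have classv y : c y = c v -> y \in [set u; v].
  have [t ct] := tc u.
  have tv : t = v.
    have /nodom/set2P[tu|//] : forall y, c y = c t -> adj u y || adj v y.
      by move=> x /ct ->.
    by have := ct t erefl; rewrite tu adj_irr.
  by move=> cy; apply: nodom => x; rewrite cy -{1}tv => /ct ->.
have classu y : c y = c u -> y \in [set u; v].
  have [t ct] := tc v.
  have tu : t = u.
    have /nodom/set2P[//|tv] : forall y, c y = c t -> adj u y || adj v y.
      by move=> x /ct ->; rewrite orbT.
    by have := ct t erefl; rewrite tv adj_irr.
  by move=> cy; apply: nodom => x; rewrite cy -{1}tu => /ct ->; rewrite orbT.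
(* This neighbor [z] becomes the singleton class that the new vertex dominates. *)
have [[z|] // wz] := niso None.
pose d (a : contract u v) : bool + 'I_#|G| :=
  if a is Some x then if x == z then inl true else inr (c (val x))
  else inl false.
have dtrue a : d a = inl true -> a = Some z.
  by case: a => //= x; case: eqP => // ->.
have dfalse a : d a = inl false -> a = None.
  by case: a => //= x; case: eqP.
have td : td_map (contract u v) _ d.
  split=> [[x|] [y|] //= xy|[x|]].
  - case: eqP xy => [->|_]; case: eqP => [->|_] //=; first by rewrite adj_irr.
    by move=> xy [] /pc; apply.
  - by case: eqP.
  - by case: eqP.
  - have [t ct] := tc (val x).
    have [tuv|nt] := boolP (t \in [set u; v]).
      exists None => a /dfalse -> /=; rewrite ![adj _ (val x)]adj_sym.
      by case/set2P: tuv ct => -> /(_ _ erefl) -> //; rewrite orbT.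
    (* The class of [t] may have lost [z], which is harmless unless [t] is [z]; then [{z}] itself is
       dominated. *)
    have [tz|tz] := eqVneq (Sub t nt) z.
      exists (Some z) => a; rewrite /= eqxx => /dtrue -> /=; apply: ct.
      by rewrite -tz.
    exists (Some (Sub t nt)) => -[y|] /=; rewrite (negPf tz) //.
    by case: eqP => // _ [] /ct.
  - by exists (Some z) => a; rewrite /= eqxx => /dtrue ->.
apply: leq_trans (chi_td_le _ _ _ td) _.
have cuK : c u \in K by rewrite imset_f.
have cvK : c v \in K :\ c u.
  by rewrite !inE imset_f // andbT eq_sym; apply/eqP/pc.
(* The distinct colors of [u] and [v] occur on no other vertex, so two fresh colors replace them and
   the total is at most [#|K|], one below the bound. *)
apply: (@leq_trans #|[set inl true; inl false] :|: inr @: (K :\ c u :\ c v)|).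
  apply/subset_leq_card/subsetP => _ /imsetP[[x|] _ ->]; rewrite !inE //=.
  case: (x =P z) => //= _; apply: imset_f; rewrite !inE.
  apply/and3P; split; last exact: imset_f.
    by apply: contra (valP x) => /eqP; apply: classv.
  by apply: contra (valP x) => /eqP; apply: classu.
apply: leq_trans (leq_card_setU _ _) _.
rewrite cards2 /= addn1 (cardsD1 (c u) K) (cardsD1 (c v) (K :\ c u)) cuK cvK.
by rewrite leqW // addnA; apply: leq_add; rewrite ?leq_imset_card.
Qed.

Theorem theorem3p1 (G : sgraph) (u v : G) :
  connected G -> adj u v ->
  no_isolated G -> no_isolated (contract u v) ->
  chi_td G - 2 <= chi_td (contract u v) <= chi_td G + 1.
Proof.
move=> _ uv nisoG niso; rewrite chi_td_contract_le // andbT leq_subLR addnC.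
exact: chi_td_le_contract.
Qed.
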